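(* Let $I:\mathcal{A}\to\mathbb{R}$ be an inconsistency index satisfying axiom A1, where full consistency corresponds to the least value of the index, i.e. $I(\mathbf{A})\ge \nu$ for all $\mathbf{A}\in\mathcal{A}$, with $\nu$ the value from A1. If $I$ fails to satisfy at least one of the axioms A3 and A4, then $I$ is not upper bounded with respect to the weighted geometric mean; that is, it is not true that $$I(\mathbf{A}^{\star})\le \max\{I(\mathbf{A}_1),\ldots,I(\mathbf{A}_m)\}$$ for all $m\ge 2$, all $\mathbf{A}_1,\ldots,\mathbf{A}_m\in\mathcal{A}$ of the same order and all $\boldsymbol{\lambda}\in\mathcal{L}_m$.
   Context: A pairwise comparison matrix of order $n$ is a real $n\times n$ matrix $\mathbf{A}=(a_{ij})$ with $a_{ij}>0$ and $a_{ij}a_{ji}=1$ for all $i,j$. $\mathcal{A}$ is the set of all pairwise comparison matrices of all orders $n>2$. $\mathcal{A}^{*}\subset\mathcal{A}$ is the set of consistent ones, i.e. those with $a_{ik}=a_{ij}a_{jk}$ for all $i,j,k$. An inconsistency index is a function $I:\mathcal{A}\to\mathbb{R}$, larger values meaning more inconsistency. $\mathcal{L}_m=\{(\lambda_1,\ldots,\lambda_m): \lambda_h\ge 0\ \forall h,\ \sum_{h=1}^m\lambda_h=1\}$. Given $\mathbf{A}_h=(a_{ij}^{(h)})_{n\times n}\in\mathcal{A}$, $h=1,\ldots,m$ (same order $n$), and $\boldsymbol{\lambda}\in\mathcal{L}_m$, the aggregated matrix $\mathbf{A}^{\star}=(a_{ij}^{\star})_{n\times n}$ is $a_{ij}^{\star}=\prod_{h=1}^m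 (a_{ij}^{(h)})^{\lambda_h}$. Axioms for $I$: A1: there is a unique $\nu\in\mathbb{R}$ such that for all $\mathbf{A}\in\mathcal{A}$, $I(\mathbf{A})=\nu\Leftrightarrow\mathbf{A}\in\mathcal{A}^{*}$. A3: for $b>1$ put $\mathbf{A}(b)=(a_{ij}^{b})_{n\times n}$; then $I(\mathbf{A}(b))\ge I(\mathbf{A})$ for all $\mathbf{A}\in\mathcal{A}$ and all $b>1$. A4: for every $\mathbf{A}\in\mathcal{A}^{*}$ and every non-diagonal entry $a_{pq}\ne 1$, let $\mathbf{A}(\delta)$ denote the matrix obtained from $\mathbf{A}$ by replacing $a_{pq}$ with $a_{pq}^{\delta}$ and $a_{qp}$ with $a_{qp}^{\delta}$ (all other entries unchanged); then $\delta'>\delta>1\Rightarrow I(\mathbf{A}(\delta'))\ge I(\mathbf{A}(\delta))$ and $\delta'<\delta<1\Rightarrow I(\mathbf{A}(\delta'))\ge I(\mathbf{A}(\delta))$. *)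

(* Defs.v *)
From mathcomp Require Import all_boot all_order all_algebra.
From mathcomp Require Import all_classical all_reals all_analysis.

Set Implicit Arguments.
Unset Strict Implicit.
Unset Printing Implicit Defensive.

Import Order.TTheory GRing.Theory Num.Theory.
Local Open Scope ring_scope.

(* The bound on the order is part of the structure, so that
   [forall n, pcm R n -> _] ranges over the matrices of all orders n > 2. *)
Record pcm (R : realType) (n : nat) : Type := Pcm {
  pcm_mx :> 'M[R]_n;
  pcm_order : (2 < n)%N;
  pcm_gt0 : forall i j, 0 < pcm_mx i j;
  pcm_recip : forall i j, pcm_mx i j * pcm_mx j i = 1
}.

Definition consistent (R : realType) (n : nat) (A : pcm R n) : Prop :=
  forall i j k, A i k = A i j * A j k.

Definition incons_index (R : realType) : Type := forall n, pcm R n -> R.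

Section Operations.
Variables (R : realType) (n : nat).

Definition power_mx (A : pcm R n) (b : R) : 'M[R]_n :=
  \matrix_(i, j) A i j `^ b.

Lemma power_gt0 A b i j : 0 < power_mx A b i j.
Proof. by rewrite mxE powR_gt0 ?pcm_gt0. Qed.

Lemma power_recip A b i j : power_mx A b i j * power_mx A b j i = 1.
Proof. by rewrite !mxE -powRM ?ltW ?pcm_gt0// pcm_recip powR1. Qed.

Definition pcm_power (A : pcm R n) (b : R) : pcm R n :=
  Pcm (pcm_order A) (power_gt0 A b) (power_recip A b).

Definition perturb_mx (A : pcm R n) (p q : 'I_n) (delta : R) : 'M[R]_n :=
  \matrix_(i, j) if ((i, j) == (p, q)) || ((i, j) == (q, p))
                 then A i j `^ delta else A i j.

Lemma perturb_gt0 A p q delta i j : 0 < perturb_mx A p q delta i j.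
Proof. by rewrite mxE; case: ifP => _; rewrite ?powR_gt0 ?pcm_gt0. Qed.

Lemma perturb_recip A p q delta i j :
  perturb_mx A p q delta i j * perturb_mx A p q delta j i = 1.
Proof.
rewrite !mxE !xpair_eqE orbC (andbC (j == p)) (andbC (j == q)).
by case: ifP => _; rewrite -?powRM ?ltW ?pcm_gt0// pcm_recip ?powR1.
Qed.

Definition pcm_perturb (A : pcm R n) (p q : 'I_n) (delta : R) : pcm R n :=
  Pcm (pcm_order A) (perturb_gt0 A p q delta) (perturb_recip A p q delta).

Definition wgm_mx (m : nat) (A : 'I_m -> pcm R n) (lambda : 'I_m -> R) :
  'M[R]_n := \matrix_(i, j) \prod_(h < m) A h i j `^ lambda h.

Lemma wgm_gt0 m (A : 'I_m -> pcm R n) lambda i j : 0 < wgm_mx A lambda i j.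
Proof. by rewrite mxE prodr_gt0// => h _; rewrite powR_gt0 ?pcm_gt0. Qed.

Lemma wgm_recip m (A : 'I_m -> pcm R n) lambda i j :
  wgm_mx A lambda i j * wgm_mx A lambda j i = 1.
Proof.
rewrite !mxE -big_split /= big1// => h _.
by rewrite -powRM ?ltW ?pcm_gt0// pcm_recip powR1.
Qed.

(* [hn] is needed because an empty family does not determine that n > 2. *)
Definition pcm_wgm (hn : (2 < n)%N) (m : nat) (A : 'I_m -> pcm R n)
    (lambda : 'I_m -> R) : pcm R n :=
  Pcm hn (wgm_gt0 A lambda) (wgm_recip A lambda).

End Operations.

Definition weights (R : realType) (m : nat) (lambda : 'I_m -> R) : Prop :=
  (forall h, 0 <= lambda h) /\ \sum_(h < m) lambda h = 1.

Definition consistency_value (R : realType) (I : incons_index R) (nu : R) :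
    Prop :=
  forall n (A : pcm R n), I n A = nu <-> consistent A.

Definition axiom_A1 (R : realType) (I : incons_index R) : Prop :=
  exists! nu : R, consistency_value I nu.

Definition axiom_A3 (R : realType) (I : incons_index R) : Prop :=
  forall n (A : pcm R n) (b : R), 1 < b -> I n A <= I n (pcm_power A b).

Definition axiom_A4 (R : realType) (I : incons_index R) : Prop :=
  forall n (A : pcm R n) (p q : 'I_n),
    consistent A -> p != q -> A p q != 1 ->
    (forall delta delta' : R, 1 < delta -> delta < delta' ->
       I n (pcm_perturb A p q delta) <= I n (pcm_perturb A p q delta')) /\
    (forall delta delta' : R, delta < 1 -> delta' < delta ->
       I n (pcm_perturb A p q delta) <= I n (pcm_perturb A p q delta')).

(* The iterated maximum starts from the value at the first index, so it is the
   maximum of the nonempty family x_0, ..., x_(m-1). *)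
Definition family_max (R : realType) (m : nat) (hm : (0 < m)%N)
    (x : 'I_m -> R) : R :=
  \big[Num.max/x (Ordinal hm)]_(h < m) x h.

Definition upper_bounded_wgm (R : realType) (I : incons_index R) : Prop :=
  forall (m : nat) (hm : (2 <= m)%N) (n : nat) (hn : (2 < n)%N)
         (A : 'I_m -> pcm R n) (lambda : 'I_m -> R),
    weights lambda ->
    I n (pcm_wgm hn A lambda) <= family_max (ltnW hm) (fun h => I n (A h)).

(* Main.v *)
(* Assume I upper bounded; weighting any matrix against a consistent one then
   cannot increase I, since a consistent matrix has the least index.
   A3: A is the mean of A(b) and the all-ones matrix, with weight 1/b on A(b).
   A4: A(delta) is the mean of A(delta') and the consistent matrix A = A(1), with
   weight (delta - 1)/(delta' - 1) on A(delta'), on either side of 1. *)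
Require Import Defs.
From mathcomp Require Import all_boot all_order all_algebra.
From mathcomp Require Import all_classical all_reals all_analysis.
From mathcomp Require Import ring lra.
Local Open Scope ring_scope.
Import Order.TTheory GRing.Theory Num.Theory.

(** Once the matrices agree, the other fields are proofs, identified by proof irrelevance. *)
Lemma pcm_eq (R : realType) (n : nat) (A B : pcm R n) : A =2 B -> A = B.
Proof.
case: A B => [A hA posA recA] [B hB posB recB] /= /matrixP AB.
by case: B / AB in posB recB *; congr Pcm; exact: Prop_irrelevance.
Qed.

Definition ones_pcm (R : realType) (n : nat) (hn : (2 < n)%N) : pcm R n.
Proof.
by refine (@Pcm R n (const_mx 1) hn _ _) => i j; rewrite !mxE ?mulr1 ?ltr01.
Defined.

Lemma ones_consistent (R : realType) (n : nat) (hn : (2 < n)%N) :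
  consistent (ones_pcm R n hn).
Proof. by move=> i j k; rewrite !mxE mulr1. Qed.

Lemma upper_bounded_mean_consistent (R : realType) (I : incons_index R)
    (nu : R) (hnu : consistency_value I nu)
    (hmin : forall (n : nat) (A : pcm R n), nu <= I n A)
    (hI : upper_bounded_wgm I) (n : nat) (A B C : pcm R n) (t : R) :
  consistent B -> 0 <= t -> t <= 1 ->
  (forall i j, C i j = A i j `^ t * B i j `^ (1 - t)) ->
  I n C <= I n A.
Proof.
move=> /hnu IB t0 t1 hC.
pose F (h : 'I_2) := if h == ord0 then A else B.
pose w (h : 'I_2) : R := if h == ord0 then t else 1 - t.
have hw : weights w.
  split; last by rewrite big_ord_recl big_ord1 /w /=; ring.
  by move=> h; rewrite /w; case: ifP; rewrite ?subr_ge0.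
have IF h : I n (F h) <= I n A by rewrite /F; case: ifP; rewrite ?IB.
have -> : C = pcm_wgm (pcm_order A) F w.
  by apply: pcm_eq => i j; rewrite mxE big_ord_recl big_ord1 /F /w /= hC.
(* The seed of the iterated maximum is itself a value of the family, so [IF] bounds it too. *)
by apply: le_trans (hI 2%N isT _ _ F w hw) _; exact: bigmax_le.
Qed.

(** Exponents of a positive base add: the two perturbed entries get [d * t + (1 - t)], all others
    [t + (1 - t) = 1]. *)
Lemma perturb_mean (R : realType) (n : nat) (A : pcm R n) (p q : 'I_n)
    (t d : R) (i j : 'I_n) :
  pcm_perturb A p q (t * d + (1 - t)) i j =
  pcm_perturb A p q d i j `^ t * A i j `^ (1 - t).
Proof.
have A0 : A i j != 0 by rewrite gt_eqF ?pcm_gt0.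
rewrite !mxE; case: ifP => _; rewrite -?powRrM -powRD ?A0 ?implybT//.
  by rewrite mulrC.
by rewrite addrC subrK powRr1 ?ltW ?pcm_gt0.
Qed.

Theorem proposition2 (R : realType) (I : incons_index R)
  (hA1 : axiom_A1 I)
  (nu : R) (hnu : consistency_value I nu)
  (hmin : forall (n : nat) (A : pcm R n), nu <= I n A)
  (hfail : ~ axiom_A3 I \/ ~ axiom_A4 I) :
  ~ upper_bounded_wgm I.
Proof.
move=> hI; have mean := upper_bounded_mean_consistent _ _ _ hnu hmin hI.
case: hfail; apply.
  move=> n A b b1; have b0 : 0 < b by apply: lt_trans b1.
  apply: (mean _ _ (ones_pcm R n (pcm_order A)) _ b^-1).
  - exact: ones_consistent.
  - by rewrite invr_ge0 ltW.
  - by rewrite invf_le1// ltW.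
  - move=> i j; rewrite !mxE powR1 mulr1 -powRrM divff ?gt_eqF//.
    by rewrite powRr1 ?ltW ?pcm_gt0.
move=> n A p q cA _ _.
(* The ratio [t] solves [t * d' + (1 - t) = d]; stating only its bounds covers both sides of 1. *)
have step d d' : d' != 1 -> 0 <= (d - 1) / (d' - 1) <= 1 ->
    I n (pcm_perturb A p q d) <= I n (pcm_perturb A p q d').
  set t := _ / _ => d'1 /andP[t0 t1].
  apply: (mean _ _ A _ t) => // i j; rewrite -perturb_mean.
  suff -> : t * d' + (1 - t) = d by [].
  have -> : t * d' + (1 - t) = t * (d' - 1) + 1 by ring.
  by rewrite divfK ?subr_eq0// subrK.
split=> d d' hd hd'; apply: step; try by apply/eqP; lra.
  by rewrite divr_ge0 ?ler_pdivrMr; lra.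
(* Below 1 both differences are negative; the ratio becomes [(1 - d) / (1 - d')], with positive
   denominator. *)
rewrite -mulrNN -invrN !opprB.
by rewrite divr_ge0 ?ler_pdivrMr; lra.
Qed.
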